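(* Let $N=q+1$, where $q$ is a prime power with $q\equiv 1\pmod 4$, and let $d$ be a positive integer. If there exists a $d\times 2d$ equiangular tight frame, then there exists a $dN\times 2dN$ equiangular tight frame.
   Context: A $d\times n$ equiangular tight frame (ETF) is a collection of $n$ unit vectors $x_1,\dots,x_n$ in $\mathbb{C}^d$ attaining the Welch bound, i.e. $\max_{i\neq j}|\langle x_i,x_j\rangle|^2=\frac{n-d}{d(n-1)}$. *)

(* Defs.v *)
From mathcomp Require Export all_boot all_order all_algebra.
From mathcomp Require Export reals complex.

Set Implicit Arguments.
Unset Strict Implicit.
Unset Printing Implicit Defensive.

Import Order.TTheory GRing.Theory Num.Theory.

Local Open Scope ring_scope.
Local Open Scope complex_scope.

Definition prime_power (q : nat) : Prop :=
  exists p k : nat, [/\ prime p, (0 < k)%N & q = (p ^ k)%N].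

(* The default value 0 only matters when there are no pairs i != j (n <= 1),
   since the other terms are nonnegative. *)
Definition max_sqr_coherence (R : realType) (d n : nat)
    (x : 'I_n -> 'rV[R[i]]_d) : R :=
  \big[Num.max/0]_(ij : 'I_n * 'I_n | ij.1 != ij.2)
    ComplexField.Normc.normc (dotmx (x ij.1) (x ij.2)) ^+ 2.

(* The vectors are rows because the library's Hermitian product dotmx is. *)
Definition is_ETF (R : realType) (d n : nat)
    (x : 'I_n -> 'rV[R[i]]_d) : Prop :=
  (forall i : 'I_n, dotmx (x i) (x i) = 1) /\
  max_sqr_coherence x = (n%:R - d%:R) / (d%:R * (n%:R - 1)).

(* Main.v *)
(* Equality in the Welch bound forces tightness, so the Gram matrix G of a
   d x 2d ETF satisfies G^2 = 2G, and S = sqrt(2d-1) (G - I) is a Hermitian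
   conference matrix of order n = 2d: zero diagonal, unimodular off-diagonal
   entries, S^2 = (n-1) I.  Conversely, if K is such a matrix of even order m,
   (I + K/sqrt(m-1))/2 is a projection of rank m/2, whose orthonormal factor
   gives an m/2 x m ETF.
   Let B be the symmetric Paley conference matrix of order N = q+1, with entries
   chi(det(u, v)) for points u, v of the projective line over F_q.  For a
   non-residue eta, the involution x -> eta/x has non-residue determinant and so
   yields a signed permutation matrix J with J^T = -J, J^2 = -I, JB = -BJ.  Then
   A = iJ + BJ is Hermitian with unimodular entries, A^2 = N I and AB = -BA, so
   S (x) A + I (x) B is a Hermitian conference matrix of order nN. *)

Require Import Defs.
From mathcomp Require Import all_boot all_order all_algebra.
From mathcomp Require Import reals complex.
From mathcomp Require Import ring zify mxtens finfield.

Set Implicit Arguments.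
Unset Strict Implicit.
Unset Printing Implicit Defensive.

Import Order.TTheory GRing.Theory Num.Theory.
Local Open Scope ring_scope.
Local Open Scope sesquilinear_scope.

(** * Frames of $2d$ vectors in dimension $d$ and Hermitian conference matrices *)

Definition hermitian_conference (C : numClosedFieldType) (n : nat)
    (K : 'M[C]_n) : Prop :=
  [/\ K^t* = K, forall i, K i i = 0, forall i j, i != j -> `|K i j| = 1
    & K *m K = (n%:R - 1)%:M].

Lemma adjmxZ_ge0 (C : numClosedFieldType) (m n : nat) (a : C) (A : 'M[C]_(m, n)) :
  0 <= a -> (a *: A)^t* = a *: A^t*.
Proof.
by move=> a_ge0; apply/matrixP => i j; rewrite !mxE rmorphM /= geC0_conj.
Qed.

Lemma mxtrace_mul_adj (C : numClosedFieldType) (m n : nat) (A : 'M[C]_(m, n)) :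
  \tr (A *m A^t*) = \sum_i \sum_j `|A i j| ^+ 2.
Proof.
by apply: eq_bigr => i _; rewrite mxE; apply: eq_bigr => j _; rewrite !mxE normCK.
Qed.

(** The squared Frobenius norm of [E = F - (n/d) I] is $tr(G^2) - n^2/d$, while the deficits
    [c - |G i j|^2] over $i \neq j$ add up to $n^2/d - tr(G^2)$. These two nonnegative quantities
    have sum zero, so every term of both vanishes. *)
Lemma welch_equality (C : numClosedFieldType) (n d : nat) (X : 'M[C]_(n, d)) :
  (0 < d)%N -> (1 < n)%N ->
  (forall i, (X *m X^t*) i i = 1) ->
  (forall i j, i != j ->
    `|(X *m X^t*) i j| ^+ 2 <= (n%:R - d%:R) / (d%:R * (n%:R - 1))) ->
  X^t* *m X = (n%:R / d%:R)%:M /\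
  forall i j, i != j ->
    `|(X *m X^t*) i j| ^+ 2 = (n%:R - d%:R) / (d%:R * (n%:R - 1)).
Proof.
move=> d_gt0 n_gt1; set G := X *m X^t*; set F := X^t* *m X => Gii Gij.
pose c : C := (n%:R - d%:R) / (d%:R * (n%:R - 1)); rewrite -/c in Gij *.
have d0 : d%:R != 0 :> C by rewrite pnatr_eq0 -lt0n.
have n1 : n%:R - 1 != 0 :> C by rewrite subr_eq0 (eqr_nat _ n 1) gtn_eqF.
pose E := F - (n%:R / d%:R)%:M.
have Fh : F^t* = F by rewrite /F trmx_mul map_mxM trmxCK.
have Gh : G^t* = G by rewrite /G trmx_mul map_mxM trmxCK.
have Eh : E^t* = E.
  rewrite /E linearB /= map_mxB Fh tr_scalar_mx map_scalar_mx.
  by congr (_ - _%:M); rewrite fmorph_div !rmorph_nat.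
have trG : \tr G = n%:R.
  by rewrite /mxtrace (eq_bigr (fun=> 1)) // sumr_const card_ord.
have trF : \tr F = n%:R by rewrite /F mxtrace_mulC trG.
have trFF : \tr (F *m F) = \tr (G *m G).
  by rewrite /F /G -!mulmxA mxtrace_mulC !mulmxA.
have sumE : \sum_i \sum_j `|E i j| ^+ 2 = \tr (G *m G) - n%:R ^+ 2 / d%:R.
  rewrite -mxtrace_mul_adj Eh /E mulmxBl !mulmxBr mul_mx_scalar mul_scalar_mx.
  rewrite -scalar_mxM !linearB !linearZ /= trFF trF mxtrace_scalar.
  rewrite -mulr_natr; field; exact: d0.
have sumG : \sum_(p : 'I_n * 'I_n | p.1 != p.2) (c - `|G p.1 p.2| ^+ 2) =
    n%:R ^+ 2 / d%:R - \tr (G *m G).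
  have -> : \sum_(p : 'I_n * 'I_n | p.1 != p.2) (c - `|G p.1 p.2| ^+ 2) =
     \sum_(i < n) (\sum_(j < n) (c - `|G i j| ^+ 2) - (c - 1)).
    rewrite -(pair_big_dep xpredT (fun i j : 'I_n => i != j)
       (fun i j => c - `|G i j| ^+ 2)) /=.
    apply: eq_bigr => i _; rewrite [in RHS](bigD1 i) //= Gii normr1 expr1n.
    rewrite addrAC subrr add0r; by apply: eq_bigl => j; rewrite [i == j]eq_sym.
  have trGG : \tr (G *m G) = \sum_i \sum_j `|G i j| ^+ 2.
    by rewrite -mxtrace_mul_adj Gh.
  rewrite trGG sumrB (eq_bigr (fun i => c *+ n - \sum_j `|G i j| ^+ 2)); last first.
    by move=> i _; rewrite sumrB sumr_const card_ord.
  rewrite sumrB !sumr_const card_ord.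
  rewrite -[c *+ n *+ n]mulr_natr -[c *+ n]mulr_natr -[(c - 1) *+ n]mulr_natr /c.
  move: (\sum_i _) d0 n1 => s; move: n%:R d%:R => a b b0 a1.
  by field; rewrite b0 a1.
have E_ge0 : 0 <= \sum_i \sum_j `|E i j| ^+ 2.
  by do 2!apply: sumr_ge0 => ? _; rewrite exprn_ge0.
have G_ge0 (p : 'I_n * 'I_n) : p.1 != p.2 -> 0 <= c - `|G p.1 p.2| ^+ 2.
  by move=> ?; rewrite subr_ge0 Gij.
have /eqP : \sum_i \sum_j `|E i j| ^+ 2 +
    \sum_(p : 'I_n * 'I_n | p.1 != p.2) (c - `|G p.1 p.2| ^+ 2) = 0.
  by rewrite sumE sumG subrKA subrr.
rewrite (paddr_eq0 E_ge0 (sumr_ge0 _ G_ge0)) => /andP[/eqP E0 /eqP G0]; split.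
  apply: subr0_eq; apply/matrixP => i j; rewrite [RHS]mxE.
  have Ei0 : \sum_j `|E i j| ^+ 2 = 0.
    apply: (psumr_eq0P _ E0) => // k _.
    by apply: sumr_ge0 => *; rewrite exprn_ge0.
  apply/eqP; rewrite -normr_eq0 -sqrf_eq0; apply/eqP.
  by apply: (psumr_eq0P _ Ei0) => // *; rewrite exprn_ge0.
move=> i j ij; apply/esym/subr0_eq.
by have /(_ (i, j) ij) := psumr_eq0P G_ge0 G0.
Qed.

(** Here the bound is $1/(2d-1)$ and tightness reads [X^t* X = 2 I], so $G^2 = 2G$ and $(G - I)^2 =
    I$; the factor $\sqrt{2d-1}$ makes the off-diagonal entries unimodular. *)
Lemma half_frame_conference (C : numClosedFieldType) (d : nat)
    (X : 'M[C]_(2 * d, d)) :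
  (0 < d)%N ->
  (forall i, (X *m X^t*) i i = 1) ->
  (forall i j, i != j -> `|(X *m X^t*) i j| ^+ 2 <=
     ((2 * d)%:R - d%:R) / (d%:R * ((2 * d)%:R - 1))) ->
  exists K : 'M[C]_(2 * d), hermitian_conference K.
Proof.
move=> d_gt0 Gii Gij.
have [|XX {}Gij] := welch_equality d_gt0 _ Gii Gij; first by lia.
have d0 : d%:R != 0 :> C by rewrite pnatr_eq0 -lt0n.
have m_gt0 : 0 < (2 * d)%:R - 1 :> C by rewrite subr_gt0 (ltr_nat _ 1); lia.
have m0 := lt0r_neq0 m_gt0.
set G := X *m X^t* in Gii Gij *; pose r : C := sqrtC ((2 * d)%:R - 1).
have r_ge0 : 0 <= r by rewrite sqrtC_ge0 ltW.
have rr : r ^+ 2 = (2 * d)%:R - 1 by rewrite sqrtCK.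
have Gh : G^t* = G by rewrite /G trmx_mul map_mxM trmxCK.
have GG : G *m G = 2 *: G.
  rewrite {1 2}/G -mulmxA [X^t* *m _]mulmxA XX mul_scalar_mx -scalemxAr.
  by congr (_ *: _); rewrite natrM mulfK.
have KE i j : (r *: (G - 1%:M)) i j = r * (G i j - (i == j)%:R).
  by move: (G) => G'; rewrite !mxE.
exists (r *: (G - 1%:M)); split.
- by rewrite adjmxZ_ge0 // linearB /= map_mxB Gh trmx1 map_mx1.
- by move=> i; rewrite KE Gii eqxx subrr mulr0.
- move=> i j ij; rewrite KE (negbTE ij) subr0 normrM (ger0_norm r_ge0).
  apply/eqP; rewrite -(@eqrXn2 _ 2) ?mulr_ge0 // expr1n exprMn rr Gij //.
  by rewrite natrM in m0 *; apply/eqP; field; rewrite m0 d0.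
rewrite -scalemxAl -scalemxAr scalerA -expr2 rr.
rewrite mulmxBl !mulmxBr !mulmx1 !mul1mx GG -[RHS]scalemx1; congr (_ *: _).
by rewrite scaler_nat mulr2n opprB addrA addrK -addrA addrC subrK.
Qed.

(** Gram-Schmidt gives an orthonormal basis [U] of the row space of [P], which [P] fixes: [U P = U],
    hence [P U^t* = U^t*]. Writing [P = D U] then yields [U^t* U = D U U^t* U = D U = P]. *)
Lemma hermitian_projection_factor (C : numClosedFieldType) (m : nat)
    (P : 'M[C]_m) :
  P^t* = P -> P *m P = P ->
  exists r (U : 'M[C]_(r, m)), U *m U^t* = 1%:M /\ U^t* *m U = P.
Proof.
move=> Ph PP.
have [r [U [UU UP]]] :
    exists r (U : 'M[C]_(r, m)), U *m U^t* = 1%:M /\ (U :=: P)%MS.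
  exists (\rank P), (schmidt (row_base P)); split.
    exact/unitarymxP/schmidt_unitarymx/rank_leq_col.
  by apply: eqmx_trans (eq_row_base P); apply/eqmx_schmidt_free/row_base_free.
exists r, U; split=> //.
have [B UB] : exists B, U = B *m P by apply/submxP; rewrite UP.
have [D PD] : exists D, P = D *m U by apply/submxP; rewrite UP.
have UPU : U *m P = U by rewrite UB -mulmxA PP.
have PU : P *m U^t* = U^t* by rewrite -{2}UPU trmx_mul map_mxM Ph.
by rewrite -PU {1}PD -(mulmxA D) UU mulmx1 -PD.
Qed.

Lemma conference_half_frame (C : numClosedFieldType) (D : nat)
    (K : 'M[C]_(2 * D)) :
  (0 < D)%N -> hermitian_conference K ->
  exists Y : 'M[C]_(2 * D, D),
    (forall i, (Y *m Y^t*) i i = 1) /\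
    (forall i j, i != j -> `|(Y *m Y^t*) i j| ^+ 2 =
     ((2 * D)%:R - D%:R) / (D%:R * ((2 * D)%:R - 1))).
Proof.
move=> D_gt0 [Kh Kii Kij KK].
have D0 : D%:R != 0 :> C by rewrite pnatr_eq0 -lt0n.
have m_gt0 : 0 < (2 * D)%:R - 1 :> C by rewrite subr_gt0 (ltr_nat _ 1); lia.
have m0 := lt0r_neq0 m_gt0.
have two0 : 2 != 0 :> C by rewrite pnatr_eq0.
pose r : C := sqrtC ((2 * D)%:R - 1).
have r_ge0 : 0 <= r by rewrite sqrtC_ge0 ltW.
have rr : r ^+ 2 = (2 * D)%:R - 1 by rewrite sqrtCK.
have r0 : r != 0 by rewrite -sqrf_eq0 rr.
pose P := 2^-1 *: (1%:M + r^-1 *: K).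
have Ph : P^t* = P.
  rewrite /P adjmxZ_ge0 ?invr_ge0 // linearD /= map_mxD adjmxZ_ge0 ?invr_ge0 //.
  by rewrite Kh trmx1 map_mx1.
have PP : P *m P = P.
  rewrite /P -scalemxAl -scalemxAr; congr (_ *: _).
  rewrite mulmxDl !mulmxDr !mulmx1 mul1mx -scalemxAl -scalemxAr KK -rr.
  rewrite scalerA scale_scalar_mx -expr2 -exprMn mulVf // expr1n.
  by rewrite [_ *: K + _]addrC -mulr2n -scaler_nat scalerA mulVf ?scale1r.
have [s [U [UU PU]]] := hermitian_projection_factor Ph PP.
(* The rank is the trace of [P], and [K] contributes nothing to it. *)
have sD : s = D.
  apply/eqP; rewrite -(eqr_nat C) -[s%:R]mxtrace1 -UU mxtrace_mulC PU.
  rewrite /P mxtraceZ mxtraceD mxtraceZ mxtrace1.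
  have -> : \tr K = 0 by apply: big1 => i _; exact: Kii.
  by rewrite mulr0 addr0 natrM mulrA mulVf ?mul1r.
rewrite {s}sD in U UU PU.
have GE : (sqrtC 2 *: U^t*) *m (sqrtC 2 *: U^t*)^t* = 1%:M + r^-1 *: K.
  rewrite adjmxZ_ge0 ?sqrtC_ge0 ?ler0n // trmxCK -scalemxAl -scalemxAr PU.
  rewrite scalerA -expr2 sqrtCK.
  by rewrite /P scalerA mulfV // scale1r.
(* The factor $\sqrt 2$ turns the Gram matrix [P] into $2P = I + K/r$, with unit diagonal. *)
exists (sqrtC 2 *: U^t*); rewrite GE; split=> [i|i j ij].
  by rewrite !mxE Kii eqxx mulr0 addr0.
rewrite !mxE (negbTE ij) add0r normrM Kij // mulr1 normfV ger0_norm //.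
by rewrite exprVn rr; rewrite natrM in m0 *; field; rewrite m0 D0.
Qed.

(** * Passage between [is_ETF] and Gram matrices *)

Lemma normc_sqr (R : realType) (z : R[i]) :
  (ComplexField.Normc.normc z ^+ 2)%:C%C = `|z| ^+ 2.
Proof. by rewrite rmorphXn. Qed.

Lemma dotmx_row (C : numClosedFieldType) (n d : nat) (X : 'M[C]_(n, d)) i j :
  dotmx (row i X) (row j X) = (X *m X^t*) i j.
Proof.
by rewrite dotmxE !mxE; apply: eq_bigr => k _; rewrite !mxE.
Qed.

(** The maximum bounds each pair only from above, which is why [half_frame_conference] starts from
    inequalities. *)
Lemma ETF_conference (R : realType) (d : nat) (x : 'I_(2 * d) -> 'rV[R[i]]_d) :
  (0 < d)%N -> is_ETF x -> exists K : 'M[R[i]]_(2 * d), hermitian_conference K.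
Proof.
move=> d_gt0 [x1 xmax]; pose X := \matrix_i x i.
have XE i j : (X *m X^t*) i j = dotmx (x i) (x j) by rewrite -dotmx_row !rowK.
apply: (half_frame_conference (X := X)) => // [i|i j ij]; rewrite XE //.
rewrite -normc_sqr.
have -> : ((2 * d)%:R - d%:R) / (d%:R * ((2 * d)%:R - 1)) =
    (max_sqr_coherence x)%:C%C.
  by rewrite xmax fmorph_div rmorphM !rmorphB !rmorph_nat rmorph1.
rewrite lecR /max_sqr_coherence.
exact: (le_bigmax_cond _ (fun p : 'I_(2 * d) * 'I_(2 * d) =>
  ComplexField.Normc.normc (dotmx (x p.1) (x p.2)) ^+ 2) (j := (i, j)) ij).
Qed.

Lemma conference_ETF (R : realType) (D : nat) (K : 'M[R[i]]_(2 * D)) :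
  (0 < D)%N -> hermitian_conference K ->
  exists y : 'I_(2 * D) -> 'rV[R[i]]_D, is_ETF y.
Proof.
move=> D_gt0 /(conference_half_frame D_gt0) [Y [Yii Yij]].
exists (fun i => row i Y); split=> [i|]; first by rewrite dotmx_row.
set c := _ / _.
have c_ge0 : 0 <= c.
  rewrite divr_ge0 ?mulr_ge0 ?subr_ge0 ?ler_nat ?(ler_nat _ 1) //; lia.
have cE (p : 'I_(2 * D) * 'I_(2 * D)) : p.1 != p.2 ->
    ComplexField.Normc.normc (dotmx (row p.1 Y) (row p.2 Y)) ^+ 2 = c.
  move=> p12; apply: (@complexI R); rewrite normc_sqr dotmx_row Yij //.
  by rewrite /c fmorph_div rmorphM !rmorphB !rmorph_nat rmorph1.
rewrite /max_sqr_coherence (eq_bigr (fun=> c)) //.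
(* The default 0 of the maximum is harmless since [c] is nonnegative; the indices 0 and 1 give a
   pair at which [c] is attained. *)
have lt0 : (0 < 2 * D)%N by lia.
have lt1 : (1 < 2 * D)%N by lia.
apply/le_anti; rewrite bigmax_le //=.
exact: (le_bigmax_cond _ (fun=> c) (j := (Ordinal lt0, Ordinal lt1))).
Qed.

(** * The tensor construction *)

Lemma tens_scalar (R : comPzRingType) (m n : nat) (a b : R) :
  (a%:M : 'M_m) *t (b%:M : 'M_n) = (a * b)%:M.
Proof.
apply/matrixP => i j.
case: (mxtens_indexP i) => i1 i2; case: (mxtens_indexP j) => j1 j2.
rewrite tensmxE !mxE (can_eq (@mxtens_indexK _ _)) xpair_eqE.
by case: (i1 == j1); case: (i2 == j2); rewrite /= ?mulr1n ?mulr0n ?mulr0 ?mul0r.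
Qed.

(** Diagonal blocks are copies of [B], the others are unimodular multiples of [A]. In the square,
    anticommutation cancels the cross terms, leaving $(n-1)N + (N-1) = nN - 1$. *)
Lemma tensor_conference (C : numClosedFieldType) (n N : nat)
    (S : 'M[C]_n) (A B : 'M[C]_N) :
  hermitian_conference S -> hermitian_conference B ->
  A^t* = A -> (forall u v, `|A u v| = 1) -> A *m A = N%:R%:M ->
  A *m B = - (B *m A) ->
  hermitian_conference (S *t A + 1%:M *t B).
Proof.
move=> [Sh Sii Sij SS] [Bh Bii Bij BB] Ah A1 AA AB.
have KE i u j v : (S *t A + 1%:M *t B) (mxtens_index (i, u)) (mxtens_index (j, v))
    = S i j * A u v + (i == j)%:R * B u v.
  by rewrite mxE !tensmxE; congr (_ + _ * _); rewrite mxE.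
split.
- rewrite linearD /= map_mxD !trmx_tens !map_mxT trmx1 map_mx1.
  by rewrite Sh Ah Bh.
- move=> k; case: (mxtens_indexP k) => i u.
  by rewrite KE Sii Bii mul0r mulr0 addr0.
- move=> k l; case: (mxtens_indexP k) => i u; case: (mxtens_indexP l) => j v.
  rewrite KE (can_eq (@mxtens_indexK _ _)) xpair_eqE.
  have [-> /= uv|ij _] := eqVneq i j; first by rewrite Sii mul0r add0r mul1r Bij.
  by rewrite mul0r addr0 normrM Sij // A1 mulr1.
rewrite mulmxDl !mulmxDr !tensmx_mul !mulmx1 !mul1mx SS AA BB AB.
have -> : S *t (- (B *m A)) = - (S *t (B *m A)).
  by apply/matrixP => k l; rewrite !mxE mulrN.
rewrite addrA subrK.
rewrite !tens_scalar -raddfD; congr (_%:M).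
by rewrite natrM; ring.
Qed.

(** * The quadratic character of a finite field *)

(** The value at -1 encodes $q \equiv 1 \pmod 4$; the value at [eta] makes [chi] nontrivial and
    keeps a non-residue at hand. *)
Definition quadratic_character (F : fieldType) (C : pzRingType) (eta : F)
    (chi : F -> C) : Prop :=
  [/\ chi 0 = 0, {morph chi : x y / x * y}, forall x, x != 0 -> chi x ^+ 2 = 1,
      chi (-1) = 1 & chi eta = -1].

(* Euler's criterion serves as the definition of the character; a non-residue
   exists because X^((q-1)/2) - 1 has fewer than q - 1 roots. *)
Lemma exists_quadratic_character (F : finFieldType) (C : numDomainType) :
  #|F| = 1 %[mod 4] ->
  exists (eta : F) (chi : F -> C), quadratic_character eta chi.
Proof.
move=> q14; pose h := #|F|.-1./2.
have q_gt1 : (1 < #|F|)%N by exact: finNzRing_gt1.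
have [q1 h_even] : #|F|.-1 = (h * 2)%N /\ ~~ odd h by rewrite /h; lia.
have h_gt0 : (0 < h)%N by lia.
have pow1 (x : F) : x != 0 -> x ^+ h = 1 \/ x ^+ h = -1.
  move=> x0; suff: (x ^+ h == 1) || (x ^+ h == -1).
    by case/orP => /eqP; [left|right].
  rewrite -sqrf_eq1 -exprM -q1.
  by apply/eqP/(mulfI x0); rewrite -exprS prednK ?expf_card ?mulr1 // ltnW.
have [eta eta0 etah] : exists2 eta : F, eta != 0 & eta ^+ h != 1.
  pose s := enum (predC1 (0 : F)).
  have p0 : 'X^h - 1 != 0 :> {poly F} by rewrite monic_neq0 ?monicXnsubC.
  have size_s : size s = (h * 2)%N by rewrite -cardE cardC1.
  have : ~~ all (root ('X^h - 1)) s.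
    apply/negP => /(max_poly_roots p0) /(_ (enum_uniq _)).
    by rewrite size_s size_XnsubC //; lia.
  case/allPn => eta; rewrite mem_enum /= => eta0; rewrite rootE !hornerE.
  by rewrite subr_eq0; exists eta.
(* The power [eta ^+ h] is -1 but not 1, so the two values of the $h$-th power are distinct and
   [chi] is multiplicative. *)
have N11 : -1 != 1 :> F by case: (pow1 eta eta0) etah => -> //; rewrite eqxx.
pose chi (x : F) : C := if x == 0 then 0 else if x ^+ h == 1 then 1 else -1.
exists eta, chi; split.
- by rewrite /chi eqxx.
- move=> x y; rewrite /chi mulf_eq0 exprMn.
  have [_|x0] /= := eqVneq x 0; first by rewrite mul0r.
  have [_|y0] /= := eqVneq y 0; first by rewrite mulr0.
  by case: (pow1 x x0) => ->; case: (pow1 y y0) => ->;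
    rewrite !(mulr1, mulrN1, opprK, eqxx, negbTE N11).
- by move=> x /negbTE x0; rewrite /chi x0; case: ifP; rewrite ?sqrrN expr1n.
- by rewrite /chi oppr_eq0 oner_eq0 -signr_odd (negbTE h_even) expr0 eqxx.
by rewrite /chi (negbTE eta0) (negbTE etah).
Qed.

(** Multiplication by [eta] permutes the field and negates the sum. *)
Lemma quadratic_character_sum (F : finFieldType) (C : numDomainType)
    (eta : F) (chi : F -> C) :
  quadratic_character eta chi -> \sum_x chi x = 0.
Proof.
move=> [chi0 chiM chi_sqr _ chi_eta].
have eta0 : eta != 0.
  apply: contra_eq_neq chi_eta => ->.
  by rewrite chi0 eq_sym oppr_eq0 oner_eq0.
have : \sum_x chi x = - \sum_x chi x.
  rewrite [LHS](reindex_inj (mulfI eta0)) -sumrN.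
  by apply: eq_bigr => x _; rewrite chiM chi_eta mulN1r.
by move/eqP; rewrite -addr_eq0 -mulr2n mulrn_eq0 => /eqP.
Qed.

(** After a shift, with [a = x - y], the term at $z \neq 0$ is [chi (1 + a / z)]. If $a \neq 0$,
    then $1 + a/z$ runs over all elements except 1, so the sum is [- chi 1]; if $a = 0$, there are
    $q - 1$ ones. *)
Lemma quadratic_character_correlation (F : finFieldType) (C : numDomainType)
    (eta : F) (chi : F -> C) (x y : F) :
  quadratic_character eta chi ->
  \sum_z chi (z - x) * chi (z - y) = (x == y)%:R * #|F|%:R - 1.
Proof.
move=> chiP; have [chi0 chiM chi_sqr _ _] := chiP.
have chi1 : chi 1 = 1.
  have := chi_sqr 1 (oner_neq0 _); rewrite expr2 => {1}<-.
  by rewrite -chiM mulr1.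
rewrite (reindex_inj (addIr x)) /=.
under eq_bigr do rewrite addrK -addrA.
set a := x - y; have -> : (x == y) = (a == 0) by rewrite subr_eq0.
rewrite (bigD1 0) //= chi0 mul0r add0r.
have [->|a0] := eqVneq a 0.
  rewrite (eq_bigr (fun=> 1)) => [|z z0]; last by rewrite addr0 -expr2 chi_sqr.
  by rewrite sumr_const cardC1 mul1r -subn1 natrB // ltnW // finNzRing_gt1.
rewrite mul0r sub0r (eq_bigr (fun z => chi (1 + a / z))) => [|z z0]; last first.
  rewrite -[z + a](@divfK _ z) // mulrDl divff // chiM mulrCA -expr2 chi_sqr //.
  by rewrite mulr1.
have := quadratic_character_sum chiP.
rewrite (reindex_inj (addrI 1)) (bigD1 0) //= addr0 chi1 => /eqP.
rewrite addrC addr_eq0 => /eqP <-.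
rewrite [RHS](reindex_onto (fun z => a / z) (fun z => a / z)) /=.
  apply: eq_bigl => z.
  have [->|z0] := eqVneq z 0; first by rewrite invr0 mulr0 eqxx.
  by rewrite mulf_neq0 ?invr_eq0 //= invfM invrK mulVKf ?eqxx.
by move=> z _; rewrite invfM invrK mulVKf.
Qed.

(** * The Paley matrix on the projective line and its twisted symmetry *)

Lemma big_option (R : nmodType) (T : finType) (f : option T -> R) :
  \sum_u f u = f None + \sum_x f (Some x).
Proof.
rewrite (bigD1 None) //=; congr (_ + _).
rewrite (reindex_omap Some id) /= => [|[]] //.
by apply: eq_bigl => x; rewrite eqxx.
Qed.

(** Matrix products can thus be computed as sums over points of the projective line instead of
    ordinals. *)
Lemma finite_to_matrix_mul (R : pzRingType) (T : finType) (f g : T -> T -> R) :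
  (\matrix_(i < #|T|, j < #|T|) f (enum_val i) (enum_val j)) *m
  (\matrix_(i < #|T|, j < #|T|) g (enum_val i) (enum_val j)) =
  \matrix_(i < #|T|, j < #|T|) \sum_w f (enum_val i) w * g w (enum_val j).
Proof.
apply/matrixP => i j; rewrite !mxE [RHS]big_enum_val.
by apply: eq_bigr => k _; rewrite !mxE.
Qed.

(* The projective line over F is [option F]: [Some x] stands for the vector
   (x, 1) and [None], the point at infinity, for (1, 0). *)
Definition paley_entry (F : fieldType) (C : pzRingType) (chi : F -> C)
    (u v : option F) : C :=
  match u, v with
  | None, None => 0
  | Some x, Some y => chi (x - y)
  | _, _ => 1
  end.

Definition moebius (F : fieldType) (eta : F) (u : option F) : option F :=
  if u is Some x then if x == 0 then None else Some (eta / x) else Some 0.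

(* [[0, eta], [1, 0]] maps the representative of u to a multiple of that of
   [moebius eta u]; this is the character of the factor. *)
Definition moebius_sign (F : fieldType) (C : pzRingType) (chi : F -> C)
    (u : option F) : C :=
  if u is Some x then if x == 0 then -1 else chi x else 1.

Section PaleyMatrix.
Variables (F : finFieldType) (C : numClosedFieldType).
Variables (eta : F) (chi : F -> C).
Hypothesis chiP : quadratic_character eta chi.

Let chi0 : chi 0 = 0. Proof. by case: chiP. Qed.
Let chiM : {morph chi : x y / x * y}. Proof. by case: chiP. Qed.
Let chi_sqr x : x != 0 -> chi x ^+ 2 = 1.
Proof. by case: chiP => ? ? sqr *; exact: sqr. Qed.
Let chiN1 : chi (-1) = 1. Proof. by case: chiP. Qed.
Let chi_eta : chi eta = -1. Proof. by case: chiP. Qed.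

Let chiN x : chi (- x) = chi x.
Proof. by rewrite -mulN1r chiM chiN1 mul1r. Qed.

Let chi_sub x y : chi (x - y) = chi (y - x).
Proof. by rewrite -chiN opprB. Qed.

Let chi_values x : x != 0 -> chi x = 1 \/ chi x = -1.
Proof. by move/chi_sqr/eqP; rewrite sqrf_eq1 => /orP[] /eqP; [left|right]. Qed.

Let chi_conj x : (chi x)^* = chi x.
Proof.
have [->|/chi_values[]->] := eqVneq x 0; first by rewrite chi0 conjC0.
  by rewrite conjC1.
by rewrite rmorphN1.
Qed.

Let chiV x : chi x^-1 = chi x.
Proof.
have [->|x0] := eqVneq x 0; first by rewrite invr0.
by rewrite -[LHS]mulr1 -(chi_sqr x0) expr2 mulrA -chiM mulVf // -chiM mul1r.
Qed.

Let eta0 : eta != 0.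
Proof.
by apply: contra_eq_neq chi_eta => ->; rewrite chi0 eq_sym oppr_eq0 oner_eq0.
Qed.

Lemma paley_entry_sym u v : paley_entry chi u v = paley_entry chi v u.
Proof. by case: u v => [x|] [y|] //=; exact: chi_sub. Qed.

Lemma paley_entry_conj u v : (paley_entry chi u v)^* = paley_entry chi u v.
Proof. by case: u v => [x|] [y|] //=; rewrite ?conjC0 ?conjC1 ?chi_conj. Qed.

Lemma paley_entry_diag u : paley_entry chi u u = 0.
Proof. by case: u => [x|] //=; rewrite subrr chi0. Qed.

Lemma paley_entry_norm u v : u != v -> `|paley_entry chi u v| = 1.
Proof.
case: u v => [x|] [y|] //=; rewrite ?normr1 // => xy.
have xy0 : x - y != 0 by rewrite subr_eq0.
by case: (chi_values xy0) => ->; rewrite ?normrN normr1.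
Qed.

(** For two affine points the point at infinity adds the 1 that the correlation sum lacks; the mixed
    cases are plain character sums. *)
Lemma paley_entry_sqr u v :
  \sum_w paley_entry chi u w * paley_entry chi w v = (u == v)%:R * #|F|%:R.
Proof.
have sum0 y : \sum_z chi (z - y) = 0.
  rewrite (reindex_inj (addIr y)) /= -[RHS](quadratic_character_sum chiP).
  by apply: eq_bigr => z _; rewrite addrK.
rewrite big_option; case: u v => [x|] [y|] /=.
- under eq_bigr do rewrite chi_sub.
  rewrite (quadratic_character_correlation _ _ chiP) mul1r.
  by rewrite (inj_eq (@Some_inj _)) addrC subrK.
- rewrite mulr0 add0r mul0r -[RHS](sum0 x).
  by apply: eq_bigr => z _; rewrite mulr1 chi_sub.
- rewrite mul0r add0r mul0r -[RHS](sum0 y).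
  by apply: eq_bigr => z _; rewrite mul1r.
by rewrite mul0r add0r mulr1 sumr_const mul1r.
Qed.

Lemma moebiusK : involutive (moebius eta).
Proof.
case=> [x|] /=; last by rewrite eqxx.
have [->|x0] //= := eqVneq x 0.
by rewrite mulf_eq0 invr_eq0 (negbTE eta0) (negbTE x0) /= invfM invrK mulVKf.
Qed.

(** The matrix [[[0, eta], [1, 0]]] squares to [eta] times the identity, so the signs at [u] and at
    its image multiply to [chi eta = -1]. *)
Lemma moebius_sign_moebius u :
  moebius_sign chi (moebius eta u) = - moebius_sign chi u.
Proof.
case: u => [x|] /=; last by rewrite eqxx.
have [_|x0] /= := eqVneq x 0; first by rewrite opprK.
rewrite mulf_eq0 invr_eq0 (negbTE eta0) (negbTE x0) /=.
by rewrite chiM chi_eta chiV mulN1r.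
Qed.

Lemma moebius_sign_sqr u : moebius_sign chi u * moebius_sign chi u = 1.
Proof.
case: u => [x|] /=; last by rewrite mulr1.
by have [_|x0] := eqVneq x 0; [rewrite mulrNN mulr1 | rewrite -expr2 chi_sqr].
Qed.

Lemma moebius_sign_conj u : (moebius_sign chi u)^* = moebius_sign chi u.
Proof.
case: u => [x|] /=; last by rewrite conjC1.
by case: ifP => _; rewrite ?rmorphN1 ?chi_conj.
Qed.

Lemma moebius_sign_norm u : `|moebius_sign chi u| = 1.
Proof.
case: u => [x|] /=; last by rewrite normr1.
have [_|/chi_values[]->] := eqVneq x 0; by rewrite ?normrN normr1.
Qed.

(* The determinant -eta of [[0, eta], [1, 0]] is a non-residue, hence the sign. *)
Lemma paley_entry_moebius u v :
  paley_entry chi (moebius eta u) (moebius eta v) =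
  - (moebius_sign chi u * moebius_sign chi v * paley_entry chi u v).
Proof.
have chi2 x : x != 0 -> chi x * chi x = 1 by move=> x0; rewrite -expr2 chi_sqr.
case: u v => [x|] [y|] /=; rewrite ?mul1r ?mulr1 ?mulr0 ?oppr0 //.
- have [->|x0] := eqVneq x 0; have [->|y0] := eqVneq y 0 => /=.
  + by rewrite subrr chi0 mulr0 oppr0.
  + by rewrite sub0r chiN mulN1r mulNr opprK chi2.
  + by rewrite subr0 mulrN1 mulNr opprK chi2.
  have -> : eta / x - eta / y = eta * (y - x) * x^-1 * y^-1.
    by field; rewrite y0 x0.
  by rewrite !chiM !chiV chi_eta (chi_sub y x); ring.
- have [_|x0] /= := eqVneq x 0; first by rewrite opprK.
  by rewrite subr0 chiM chiV chi_eta mulN1r.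
- have [_|y0] /= := eqVneq y 0; first by rewrite opprK.
  by rewrite sub0r chiN chiM chiV chi_eta mulN1r.
by rewrite addr0 chi0.
Qed.

End PaleyMatrix.

(** * The anticommuting pair [A], [B] *)

Lemma paley_conference (F : finFieldType) (C : numClosedFieldType) :
  #|F| = 1 %[mod 4] ->
  exists A B : 'M[C]_(#|{: option F}|),
    [/\ hermitian_conference B, A^t* = A, forall u v, `|A u v| = 1,
        A *m A = (#|{: option F}|)%:R%:M & A *m B = - (B *m A)].
Proof.
move=> /(exists_quadratic_character C) [eta [chi chiP]].
pose mx f : 'M[C]_(#|{: option F}|) := \matrix_(i, j) f (enum_val i) (enum_val j).
pose s := moebius_sign chi; pose P := paley_entry chi; pose pi := moebius eta.
have piK : involutive pi by exact: moebiusK chiP.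
pose Jf u v := s v * (u == pi v)%:R.
have delta (i j : 'I_#|{: option F}|) (c : C) :
    (enum_val i == enum_val j)%:R * c = (c%:M : 'M_#|{: option F}|) i j.
  by rewrite mxE (inj_eq enum_val_inj) mulr_natl.
have qE : #|{: option F}|%:R - 1 = #|F|%:R :> C.
  by rewrite card_option -addn1 natrD addrK.
pose B := mx P; pose J := mx Jf.
have Bh : B^t* = B.
  by apply/matrixP => i j; rewrite !mxE (paley_entry_conj chiP)
    (paley_entry_sym chiP).
have BB : B *m B = #|F|%:R%:M.
  rewrite /B finite_to_matrix_mul; apply/matrixP => i j.
  by rewrite mxE (paley_entry_sqr chiP) delta.
have Jh : J^t* = - J.
  apply/matrixP => i j; rewrite !mxE /Jf rmorphM rmorph_nat /=.
  rewrite (moebius_sign_conj chiP).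
  rewrite [enum_val j == _]eq_sym (can2_eq piK piK).
  have [->|_] := eqVneq; last by rewrite !mulr0 oppr0.
  by rewrite /s (moebius_sign_moebius chiP) mulNr.
have BJf u v : \sum_w P u w * Jf w v = s v * P u (pi v).
  rewrite (bigD1 (pi v)) //= /Jf eqxx mulr1 big1 ?addr0 1?mulrC // => w.
  by move=> /negbTE ->; rewrite !mulr0.
have JBf u v : \sum_w Jf u w * P w v = - (s v * P u (pi v)).
  rewrite (bigD1 (pi u)) //= /Jf piK eqxx mulr1 big1 ?addr0 => [|w wu]; last first.
    by rewrite -(can2_eq piK piK) eq_sym (negbTE wu) mulr0 mul0r.
  (* Writing [v] as [pi (pi v)] makes both arguments images under [pi], so that the symmetry of [P]
     applies. *)
  rewrite -{1}(piK v) /P (paley_entry_moebius chiP) /s !(moebius_sign_moebius chiP).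
  transitivity (- ((s u * s u) * (s v * P u (pi v)))); first by rewrite /s /P; ring.
  by rewrite /s (moebius_sign_sqr chiP) mul1r.
have JJ : J *m J = - 1%:M.
  rewrite /J finite_to_matrix_mul; apply/matrixP => i j; rewrite [LHS]mxE.
  rewrite (bigD1 (pi (enum_val j))) //= big1 ?addr0 => [|w wj]; last first.
    by rewrite /Jf (negbTE wj) !mulr0.
  rewrite /Jf piK eqxx mulr1 /s (moebius_sign_moebius chiP) mulrAC mulNr.
  by rewrite (moebius_sign_sqr chiP) // mulrC mulrN1 [RHS]mxE -delta mulr1.
have JB : J *m B = - (B *m J).
  rewrite /J /B !finite_to_matrix_mul; apply/matrixP => i j.
  by rewrite [LHS]mxE JBf [RHS]mxE [in RHS]mxE BJf.
have JBJ : J *m (B *m J) = B by rewrite mulmxA JB mulNmx -mulmxA JJ mulmxN mulmx1 opprK.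
exists ('i *: J + B *m J), B; split.
- split=> //.
  + by move=> i; rewrite mxE /P (paley_entry_diag chiP).
  + move=> i j ij; rewrite mxE /P (paley_entry_norm chiP) //.
    by rewrite (inj_eq enum_val_inj).
  by rewrite BB qE.
(* Both summands are Hermitian: conjugating ['i] compensates [J^t* = - J], and the adjoint of [B J]
   is [- J B = B J]. *)
- have -> : ('i *: J + B *m J)^t* = - 'i *: J^t* + J^t* *m B^t*.
    rewrite -map_mxM -trmx_mul linearD /= map_mxD; congr (_ + _).
    by apply/matrixP => i j; rewrite !mxE [LHS]rmorphM /= conjCi.
  by rewrite Jh Bh mulNmx JB opprK scalerN scaleNr opprK.
(* The term with ['i] fills exactly the zeros of [B J], which lie where the row point is [pi] of the
   column point. *)
- move=> i j; have -> : ('i *: J + B *m J) i j = s (enum_val j) *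
     ('i * (enum_val i == pi (enum_val j))%:R + P (enum_val i) (pi (enum_val j))).
    rewrite /B /J finite_to_matrix_mul !mxE BJf /Jf; ring.
  rewrite normrM (moebius_sign_norm chiP) // mul1r.
  have [->|ij] := eqVneq.
    by rewrite /P (paley_entry_diag chiP) addr0 mulr1 normCi.
  by rewrite mulr0 add0r /P (paley_entry_norm chiP).
(* The square is $-J^2 + i(JBJ + BJ^2) + BJBJ$; since $JBJ = B$ and $J^2 = -I$, it equals $I + B^2 =
   (1 + q) I$. *)
- rewrite mulmxDl !mulmxDr -!scalemxAl -!scalemxAr scalerA -expr2 sqrCi JJ JBJ.
  rewrite -!mulmxA JJ JBJ mulmxN mulmx1 BB !scalerN addrA addrK.
  by rewrite scaleN1r opprK -raddfD; congr (_%:M); rewrite -qE addrC subrK.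
rewrite mulmxDl mulmxDr -scalemxAl -scalemxAr JB -mulmxA JB mulmxN scalerN.
by rewrite opprD.
Qed.

Theorem theorem4 (R : realType) (q N d : nat) :
  prime_power q -> q = 1 %[mod 4] -> N = (q + 1)%N -> (0 < d)%N ->
  (exists x : 'I_(2 * d) -> 'rV[R[i]]_d, is_ETF x) ->
  exists y : 'I_(2 * (d * N)) -> 'rV[R[i]]_(d * N), is_ETF y.
Proof.
move=> [p [k [p_prime k_gt0 qE]]] q14 NE d_gt0 [x /(ETF_conference d_gt0) [S Sconf]].
have [F _ cardF] := pPrimePowerField p_prime k_gt0.
rewrite -qE in cardF; rewrite -cardF in q14.
have [A [B [Bconf Ah A1 AA AB]]] := paley_conference R[i] q14.
have Kconf := tensor_conference Sconf Bconf Ah A1 AA AB.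
have cardN : #|{: option F}| = N by rewrite card_option cardF NE addn1.
(* Forgetting the tensor form of the matrix allows its order to be rewritten as [2 * (d * N)]. *)
move: (_ + _) Kconf; rewrite cardN -mulnA => K Kconf.
by apply: conference_ETF Kconf; rewrite muln_gt0 d_gt0 NE addn1.
Qed.
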